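(* Let $H>0$ be the entropy of the Plancherel measure, i.e. the constant for which $\lim_{n\to\infty}\mathbb{P}l^{(n)}\{\lambda\in\mathbb{Y}_n: |H+\frac{\log\mathbb{P}l^{(n)}(\lambda)}{\sqrt n}|\le\varepsilon\}=1$ for every $\varepsilon>0$. For any $\varepsilon>0$ there exists $n_0>0$ such that for any $n\in\mathbb{N}$, $n>n_0$, there exists a subset $\mathbb{Y}_n(\varepsilon)\subset\mathbb{Y}_n$ with the following properties: (1) the cardinality of $\mathbb{Y}_n(\varepsilon)$ satisfies $$e^{(H-\varepsilon)\sqrt n}\le \#\mathbb{Y}_n(\varepsilon)\le e^{(H+\varepsilon)\sqrt n};$$ (2) for each $\lambda\in\mathbb{Y}_n(\varepsilon)$ we have $$e^{-(H+\varepsilon)\sqrt n}\le\mathbb{P}l^{(n)}(\lambda)\le e^{-(H-\varepsilon)\sqrt n}.$$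
   Context: For $n\in\mathbb{N}$, $\mathbb{Y}_n$ is the set of Young diagrams with $n$ cells (partitions of $n$). For $\lambda\in\mathbb{Y}_n$, $\dim\lambda$ is the dimension of the irreducible representation of the symmetric group on $n$ elements corresponding to $\lambda$. The Plancherel probability measure $\mathbb{P}l^{(n)}$ on $\mathbb{Y}_n$ is $\mathbb{P}l^{(n)}(\lambda)=\frac{(\dim\lambda)^2}{n!}$. It is a theorem that a constant $H>0$ with the property stated at the beginning of the claim exists (it is clearly unique). *)

(* Defs.v *)
From HB Require Import structures.
From mathcomp Require Import all_boot all_order all_algebra all_fingroup.
From mathcomp Require Import algC mxrepresentation.
From mathcomp Require Import all_classical all_reals all_analysis.
Set Implicit Arguments.
Unset Strict Implicit.
Unset Printing Implicit Defensive.
Import Order.TTheory GRing.Theory Num.Theory.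
Import numFieldNormedType.Exports.
Local Open Scope ring_scope.

(* A diagram with n cells is encoded by its row lengths padded with zeros:
   l_1 >= ... >= l_n >= 0 with l_1 + ... + l_n = n. A partition of n has at
   most n parts, each at most n, so nothing is lost. *)
Definition is_young (n : nat) (t : n.-tuple 'I_n.+1) : bool :=
  let s := [seq val k | k <- t] in sorted geq s && (sumn s == n).

Definition young (n : nat) := {t : n.-tuple 'I_n.+1 | is_young t}.

Definition rows (n : nat) (l : young n) : seq nat :=
  [seq nat_of_ord k | k <- val l].

Section IrreducibleRepresentation.
Variables (n : nat) (l : young n).

(* The cells are numbered 0, ..., n-1 in reading order, row after row; the
   i-th one lies in row [cell_row i] and column [cell_col i]. *)
Definition cell_row (i : 'I_n) : nat := reshape_index (rows l) i.
Definition cell_col (i : 'I_n) : nat := reshape_offset (rows l) i.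

Definition row_stab : {set 'S_n} :=
  [set s : 'S_n | [forall i, cell_row (s i) == cell_row i]]%SET.
Definition col_stab : {set 'S_n} :=
  [set s : 'S_n | [forall i, cell_col (s i) == cell_col i]]%SET.

Definition sym_reg := regular_repr algC [set: 'S_n]%G.

(* The Young symmetrizer, as an element of the group algebra in its (faithful)
   regular representation. *)
Definition young_symmetrizer : 'M[algC]_#|[set: 'S_n]%G| :=
  (\sum_(s in row_stab) sym_reg s) *m
  (\sum_(s in col_stab) (-1) ^+ odd_perm s *: sym_reg s).

(* The irreducible complex representation attached to l is the Specht module,
   i.e. the ideal of the group algebra generated by the Young symmetrizer. It
   is a right ideal, since matrix representations act on row vectors. *)
Definition specht_mx : 'M[algC]_#|[set: 'S_n]%G| :=
  cyclic_mx sym_reg (gring_row young_symmetrizer).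

Definition specht_repr :
    mx_representation algC [set: 'S_n]%G (\rank specht_mx) :=
  submod_repr (cyclic_mx_module sym_reg (gring_row young_symmetrizer)).

Definition young_dim : nat := \rank specht_mx.

End IrreducibleRepresentation.

Section Plancherel.
Variables (R : realType) (n : nat).

Definition plancherel (l : young n) : R := (young_dim l)%:R ^+ 2 / n`!%:R.

Definition plancherel_prob (A : {set young n}) : R :=
  \sum_(l in A) plancherel l.

Definition typical_set (H eps : R) : {set young n} :=
  [set l | `|H + ln (plancherel l) / Num.sqrt n%:R| <= eps]%SET.

End Plancherel.

Definition is_plancherel_entropy (R : realType) (H : R) : Prop :=
  forall eps : R, 0 < eps ->
    ((fun n : nat => plancherel_prob R (typical_set n H eps)) @ \oo
       --> (1 : R))%classic.

(* Main.v *)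
(* On the set where -log Pl(n) / sqrt n is within d of H, each atom has mass
   e^(-(H +- d) sqrt n), while the total mass tends to 1; comparing the total
   mass with the number of atoms bounds the cardinality up to a factor 2, which
   the gap between d and eps absorbs for large n. *)
Require Import Defs.
From HB Require Import structures.
From mathcomp Require Import all_boot all_order all_algebra.
From mathcomp Require Import all_classical all_reals all_analysis.
From mathcomp Require Import ring lra.
Import Order.TTheory GRing.Theory Num.Theory.
Import numFieldNormedType.Exports.
Local Open Scope ring_scope.

(* [ln 0 = 0], so [d < H] is what keeps diagrams of mass 0 out of the typical
   set. *)
Lemma typical_set_bounds (R : realType) (n : nat) (H d : R) (l : young n) :
  (0 < n)%N -> d < H -> l \in typical_set n H d ->
  expR (- (H + d) * Num.sqrt n%:R) <= plancherel R l
    <= expR (- (H - d) * Num.sqrt n%:R).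
Proof.
move=> n_gt0 dH; rewrite finset.inE ler_norml => /andP[lo up].
have s_gt0 : 0 < Num.sqrt n%:R :> R by rewrite sqrtr_gt0 ltr0n.
have P_ge0 : 0 <= plancherel R l.
  by rewrite /plancherel divr_ge0 ?exprn_ge0 ?ler0n.
have P_gt0 : 0 < plancherel R l.
  rewrite lt_neqAle P_ge0 andbT eq_sym; apply/negP => /eqP P0.
  by move: up; rewrite P0 ln0 // mul0r addr0 leNgt dH.
rewrite -[plancherel R l]lnK ?posrE // !ler_expR.
by apply/andP; split; [rewrite -ler_pdivlMr | rewrite -ler_pdivrMr] => //; lra.
Qed.

Lemma cardM_sum_bounds (R : numDomainType) (T : finType) (A : {set T})
    (f : T -> R) (a b : R) :
  (forall x, x \in A -> a <= f x <= b) ->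
  #|A|%:R * a <= \sum_(x in A) f x <= #|A|%:R * b.
Proof.
move=> fab; rewrite ![#|A|%:R * _]mulr_natl -!sumr_const.
by apply/andP; split; apply: ler_sum => x /fab/andP[].
Qed.

(** Since [1 + x <= expR x], it suffices that [c * Num.sqrt n%:R >= 1], which holds once
    [n >= c^-2]. *)
Lemma near_expR_sqrt_ge2 (R : realType) (c : R) : 0 < c ->
  \forall n \near \oo%classic, 2 <= expR (c * Num.sqrt n%:R) :> R.
Proof.
move=> c_gt0; near=> n.
have c_le : c^-1 <= Num.sqrt n%:R.
  rewrite -[c^-1]gtr0_norm ?invr_gt0 // -sqrtr_sqr.
  apply: ler_wsqrtr.
  by near: n; exact: nbhs_infty_ger.
apply: le_trans (expR_ge1Dx _); rewrite -[2]/(1 + 1) lerD2l.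
by rewrite -ler_pdivrMl ?mulr1.
Unshelve. all: by end_near.
Qed.

Theorem corollary1p2 (R : realType) (H : R) (H_gt0 : 0 < H)
    (H_entropy : is_plancherel_entropy H) (eps : R) (eps_gt0 : 0 < eps) :
  exists n0 : nat, (0 < n0)%N /\
    forall n : nat, (n0 < n)%N ->
      exists Yeps : {set young n},
        (expR ((H - eps) * Num.sqrt n%:R) <= #|Yeps|%:R
           <= expR ((H + eps) * Num.sqrt n%:R)) /\
        (forall l : young n, l \in Yeps ->
           expR (- (H + eps) * Num.sqrt n%:R) <= plancherel R l
             <= expR (- (H - eps) * Num.sqrt n%:R)).
Proof.
(* The minimum with [H] and the halving give [d < H], which excludes atoms of mass 0, and [d < eps],
   which leaves a positive gap. *)
pose d := Num.min eps H / 2.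
have m_gt0 : 0 < Num.min eps H by rewrite lt_min eps_gt0.
have m_eps : Num.min eps H <= eps by rewrite ge_min lexx.
have m_H : Num.min eps H <= H by rewrite ge_min lexx orbT.
have d_gt0 : 0 < d by rewrite /d; lra.
have d_lt_eps : d < eps by rewrite /d; lra.
have d_lt_H : d < H by rewrite /d; lra.
have gap_gt0 : 0 < eps - d by rewrite subr_gt0.
(* Tolerance 1/2 puts the mass of the typical set eventually in [1/2, 3/2]. *)
have half_gt0 : 0 < 2^-1 :> R by rewrite invr_gt0.
have /cvgrPdist_le/(_ _ half_gt0) prob_near1 := H_entropy _ d_gt0.
have [N _ large] := filterI prob_near1 (near_expR_sqrt_ge2 _ _ gap_gt0).
exists N.+1; split=> // n N_lt_n.
have [prob1 gap2] := large n (ltnW (ltnW N_lt_n)).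
have n_gt0 : (0 < n)%N by apply: leq_ltn_trans N_lt_n.
have s_ge0 : 0 <= Num.sqrt n%:R :> R by exact: sqrtr_ge0.
have atom l := @typical_set_bounds R n H d l n_gt0 d_lt_H.
(* Property (2) only weakens [d] to [eps]; the cardinality remains. *)
exists (typical_set n H d); split; last first.
  move=> l /atom/andP[lo up]; apply/andP; split.
    by apply: le_trans lo; rewrite ler_expR ler_wpM2r //; lra.
  by apply: le_trans up _; rewrite ler_expR ler_wpM2r //; lra.
(* The lower bound on the atoms limits their number from above, and the upper bound from below. *)
have /andP[card_up card_lo] :=
  @cardM_sum_bounds R _ (typical_set n H d) (@plancherel R n) _ _ atom.
move: prob1; rewrite ler_norml => /andP[prob_up prob_lo].
rewrite /= /plancherel_prob in prob_up prob_lo gap2.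
set S := \sum_(l in _) _ in card_up card_lo prob_up prob_lo.
have S_le2 : S <= 2 by lra.
have S2_ge1 : 1 <= 2 * S by lra.
apply/andP; split.
(* With s the root of n: #A e^((eps-d)s) >= 2 #A >= 2 S e^((H-d)s) >= e^((H-d)s), where A is the
   typical set. *)
- have -> : (H - eps) * Num.sqrt n%:R =
      (H - d) * Num.sqrt n%:R - (eps - d) * Num.sqrt n%:R by ring.
  rewrite expRD expRN ler_pdivrMr ?expR_gt0 //.
  apply: (@le_trans _ _ (#|typical_set n H d|%:R * 2)); last first.
    by rewrite ler_wpM2l.
  move: card_lo; rewrite mulNr expRN ler_pdivlMr ?expR_gt0 // => card_lo.
  have E_gt0 := expR_gt0 ((H - d) * Num.sqrt n%:R); nra.
(* Dually, #A <= S e^((H+d)s) and S <= 2 <= e^((eps-d)s). *)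
- have -> : (H + eps) * Num.sqrt n%:R =
      (H + d) * Num.sqrt n%:R + (eps - d) * Num.sqrt n%:R by ring.
  move: card_up; rewrite mulNr expRN ler_pdivrMr ?expR_gt0 // => card_up.
  rewrite expRD; apply: (le_trans card_up); rewrite mulrC.
  by rewrite ler_wpM2l ?expR_ge0 //; exact: le_trans gap2.
Qed.
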